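(* Let $p$ be a prime number, let $x\in\mathbb Z(p^\infty)$ be a non-zero element, let $\{n_k\}\subseteq\mathbb N$ be a strictly increasing sequence of positive integers, and set $$a_k=-x+e_{n_k}=-x+\frac1{p^{n_k}}\in\mathbb Z(p^\infty).$$ (a) $\{a_k\}$ is a $T$-sequence in $\mathbb Z(p^\infty)$ if and only if $n_{k+1}-n_k\to\infty$. (b) $\{a_k\}$ is a $T$-sequence in $\mathbb Z(p^\infty)$ if and only if it is a $TB$-sequence. In this case, $\mathbb Z(p^\infty)\{a_k\}$ is maximally almost-periodic, and it has $\mathfrak c$ many faithful (i.e. injective) continuous characters (in particular, the group of continuous characters of $\mathbb Z(p^\infty)\{a_k\}$ has cardinality $\mathfrak c$).
   Context: $\mathbb Z(p^\infty)$ is the Prüfer group, i.e. the subgroup of $\mathbb Q/\mathbb Z$ consisting of the elements of $p$-power order, and $e_n=\frac1{p^n}\in\mathbb Z(p^\infty)$ (taken modulo $\mathbb{Z}$). $\mathfrak c$ is the cardinality of the continuum. A sequence $\{a_n\}$ in a group $G$ is a $T$-sequence if there is a Hausdorff group topology $\tau$ on $G$ such that $a_n\to 0$ (the neutral element) in $\tau$. In this case $G\{a_n\}$ denotes $G$ equipped with the finest group topology in which $a_n\to 0$. A topological abelian group $A$ is precompact if for every neighborhood $U$ of zero there is a finite subset $F\subseteq A$ with $A=F+U$. A sequence is a $TB$-sequence in a group $G$ if there is a precompact Hausdorff group topology on $G$ in which it converges to $0$. A continuous character of an abelian topological group $A$ is a continuous homomorphism $\chi\colon A\to\mathbb T=\mathbb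 R/\mathbb Z$. The von Neumann radical of $A$ is $\mathbf n(A)=\bigcap_\chi\ker\chi$, over all continuous characters $\chi$ of $A$; $A$ is maximally almost-periodic if $\mathbf n(A)=\{0\}$. *)

(* Defs.v *)
From HB Require Import structures.
From mathcomp Require Import all_boot all_order all_algebra.
From mathcomp Require Import all_classical all_reals all_analysis.
Import numFieldNormedType.Exports.

Set Implicit Arguments.
Unset Strict Implicit.
Unset Printing Implicit Defensive.

Import Order.TTheory GRing.Theory Num.Theory.
Local Open Scope classical_set_scope.
Local Open Scope ring_scope.

Definition mod_int (K : archiNumDomainType) : Type :=
  Quotient.quot (GRing.ZmodClosed.clone K (@Num.int_num_subdef K) _).
HB.instance Definition _ K := ZmodQuotient.on (mod_int K).

(* [circle R] carries the quotient topology.  It is redefined here because the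
   Choice structure of the library's [quotient_topology] is not the one of the
   quotient group, so that the two structures cannot be joined. *)
Definition circle (R : realType) : Type := mod_int R.

Section circle_topology.
Variable R : realType.
Local Notation C := (circle R).
HB.instance Definition _ := ZmodQuotient.on C.

Definition circle_open : set_system C := [set U | open (\pi_C%qT @^-1` U)].

Lemma circle_openT : circle_open setT.
Proof. by rewrite /circle_open/= preimage_setT; exact: openT. Qed.

Lemma circle_openI : setI_closed circle_open.
Proof.
by move=> A B oA oB; rewrite /circle_open/= preimage_setI; exact: openI.
Qed.

Lemma circle_open_bigcup (I : Type) (f : I -> set C) :
  (forall i, circle_open (f i)) -> circle_open (\bigcup_i f i).
Proof.
move=> of_; rewrite /circle_open/= preimage_bigcup.
by apply: bigcup_open => i _; exact: of_.
Qed.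

HB.instance Definition _ :=
  isOpenTopological.Build C circle_openT circle_openI circle_open_bigcup.
End circle_topology.

(* For [p] prime, being annihilated by a power of [p] is having [p]-power order. *)
Definition prufer_pred (p : nat) : {pred mod_int rat} :=
  [pred x | `[< exists k : nat, x *+ (p ^ k) = 0 >]].

Lemma prufer_pred_zmod_closed p : zmod_closed (prufer_pred p).
Proof.
split=> [|x y]; first by apply/asboolP; exists 0%N; rewrite mul0rn.
move=> /asboolP[k xk] /asboolP[l yl]; apply/asboolP; exists (k + l)%N.
by rewrite mulrnBl expnD mulrnA xk mul0rn mulnC mulrnA yl mul0rn subr0.
Qed.

HB.instance Definition _ p :=
  GRing.isZmodClosed.Build (mod_int rat) (prufer_pred p)
    (prufer_pred_zmod_closed p).

Record prufer (p : nat) : Type := Prufer {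
  prufer_val : mod_int rat;
  prufer_valP : prufer_val \in prufer_pred p }.

HB.instance Definition _ p := [isSub for @prufer_val p].
HB.instance Definition _ p := [Choice of prufer p by <:].
HB.instance Definition _ p := [SubChoice_isSubZmodule of prufer p by <:].

Lemma prufer_e_subproof (p n : nat) :
  \pi_(mod_int rat)%qT ((p ^ n)%:R^-1) \in prufer_pred p.
Proof.
apply/asboolP; exists n; rewrite -raddfMn/= -[RHS](raddf0 \pi_(mod_int rat)%qT).
apply/eqP; rewrite -Quotient.idealrBE subr0 -[_ *+ _]mulr_natr.
have [->|pn0] := eqVneq ((p ^ n)%:R : rat) 0; first by rewrite mulr0.
by rewrite mulVf.
Qed.

(* The class of [1 / p ^ n] modulo the integers. *)
Definition prufer_e (p n : nat) : prufer p := Prufer (prufer_e_subproof p n).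

Record topology_on (T : Type) := TopologyOn {
  open_in : set_system T;
  open_inT : open_in setT;
  open_inI : setI_closed open_in;
  open_in_bigcup : forall (I : Type) (f : I -> set T),
    (forall i, open_in (f i)) -> open_in (\bigcup_i f i) }.

Definition topologized (T : Type) (t : topology_on T) : Type := T.

HB.instance Definition _ (G : zmodType) (t : topology_on G) :=
  GRing.Zmodule.on (topologized t).
HB.instance Definition _ (G : zmodType) (t : topology_on G) :=
  isOpenTopological.Build (topologized t)
    (open_inT t) (@open_inI _ t) (@open_in_bigcup _ t).

Record group_topology (G : zmodType) := GroupTopology {
  group_topology_on :> topology_on G;
  group_topology_sub : continuous
    (fun z : topologized group_topology_on * topologized group_topology_on =>
      (z.1 - z.2 : topologized group_topology_on)) }.

Definition with_topology (G : zmodType) (t : group_topology G) : Type :=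
  topologized t.

HB.instance Definition _ (G : zmodType) (t : group_topology G) :=
  PreTopologicalZmodule.on (with_topology t).
HB.instance Definition _ (G : zmodType) (t : group_topology G) :=
  PreTopologicalNmodule_isTopologicalZmodule.Build (with_topology t)
    (@group_topology_sub G t).

Definition converges_to_0 (G : zmodType) (a : nat -> G) (t : group_topology G) :=
  (a : nat -> with_topology t) @ \oo --> (0 : with_topology t).

Definition T_sequence (G : zmodType) (a : nat -> G) : Prop :=
  exists t : group_topology G,
    hausdorff_space (with_topology t) /\ converges_to_0 a t.

Definition precompact_group (A : topologicalZmodType) : Prop :=
  forall U : set A, nbhs 0 U ->
    exists2 F : set A, finite_set F &
      [set: A] = [set f + u | f in F & u in U].

Definition TB_sequence (G : zmodType) (a : nat -> G) : Prop :=
  exists t : group_topology G,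
    [/\ precompact_group (with_topology t),
        hausdorff_space (with_topology t) & converges_to_0 a t].

Section finest.
Variables (G : zmodType) (a : nat -> G).

(* [a] converges to 0 for the supremum of all such topologies, so that this
   supremum is the finest one. *)
Let I := {t : group_topology G | converges_to_0 a t}.
Let S := sup_topology
  (fun i : I => Topological.class (with_topology (sval i)) : Topological G).
Let open_sup : set_system G := @open S.

Let open_supT : open_sup setT. Proof. exact: (@openT S). Qed.
Let open_supI : setI_closed open_sup. Proof. exact: (@openI S). Qed.
Let open_sup_bigcup (J : Type) (f : J -> set G) :
  (forall j, open_sup (f j)) -> open_sup (\bigcup_j f j).
Proof. by move=> of_; apply: (@bigcup_open S) => j _; exact: of_. Qed.

Definition finest_topology_on : topology_on G :=
  TopologyOn open_supT open_supI open_sup_bigcup.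

Let F := topologized finest_topology_on.

Let nbhs_finest (x : G) : nbhs (x : F) = nbhs (x : S).
Proof.
apply/seteqP; split=> A /=; rewrite !nbhsE => -[B [oB Bx] BA];
  by exists B => //; split.
Qed.

Let cvg_finest (H : set_system G) (x : G) : Filter H ->
  H --> (x : F) <->
  forall i : I, H --> (x : with_topology (sval i)).
Proof.
move=> FH; rewrite nbhs_finest; exact: (cvg_sup _ _).
Qed.

Let finest_sub : continuous (fun z : F * F => (z.1 - z.2 : F)).
Proof.
move=> z; apply/cvg_finest => i.
set Ti := with_topology (sval i).
apply: cvg_trans (@sub_continuous Ti z).
apply: cvg_app => A [[B1 B2] /= [n1 n2] BA].
have sub x : nbhs (x : F) --> nbhs (x : Ti).
  exact: ((cvg_finest x _).1 (fun A h => h) i).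
by exists (B1, B2) => //=; split; exact: sub.
Qed.

Definition finest_group_topology : group_topology G := GroupTopology finest_sub.

Lemma finest_group_topology_cvg : converges_to_0 a finest_group_topology.
Proof. by apply/cvg_finest => -[t]. Qed.

Lemma finest_group_topologyP (t : group_topology G) :
  converges_to_0 a t -> open_in t `<=` open_in finest_group_topology.
Proof.
move=> at0 U oU; suff : @open F U by [].
rewrite openE => x Ux; rewrite /interior.
have : nbhs (x : F) --> (x : with_topology t).
  exact: ((cvg_finest x _).1 (fun A h => h) (exist _ t at0)).
by apply; apply: (@open_nbhs_nbhs (with_topology t)); split.
Qed.

End finest.

(* The topological group [G{a_n}].  When [a] is a [T]-sequence, its topology is
   finer than a Hausdorff one, hence Hausdorff. *)
Definition finest_group (G : zmodType) (a : nat -> G) : topologicalZmodType :=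
  with_topology (finest_group_topology a).

Section characters.
Variables (R : realType) (A : topologicalZmodType).

Definition continuous_characters : set (A -> circle R) :=
  [set chi | zmod_morphism chi /\ continuous chi].

Definition von_neumann_radical : set A :=
  \bigcap_(chi in continuous_characters) [set x | chi x = 0].

Definition maximally_almost_periodic : Prop := von_neumann_radical = [set 0].

Definition faithful_characters : set (A -> circle R) :=
  [set chi | continuous_characters chi /\ injective chi].

End characters.

Arguments continuous_characters R A _ : clear implicits.
Arguments von_neumann_radical R A _ : clear implicits.
Arguments maximally_almost_periodic R A : clear implicits.
Arguments faithful_characters R A _ : clear implicits.

(* Main.v *)
(* If the gaps n_(k+1) - n_k do not tend to infinity, some m equals infinitely
   many of them, and then p^m a_(k+1) - a_k is infinitely often the non-zero
   constant x - p^m x, so a cannot converge to 0 in a Hausdorff group topology.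
   Conversely, write x = c e_s.  When the gaps tend to infinity, multiplication
   by a p-adic integer
     z = 1 + \sum_(j >= K) (c / p^s + b_j) p^(n_j),  b_j in {0, 1},
   fixes x and maps e_(n_k) to x plus an error of order p^(n_(k-1) - n_k), so
   the character it induces sends a_k to 0; since z = 1 modulo p, this
   character is injective.  The initial topology of one such character is
   precompact and Hausdorff, and the free digits b_j yield continuum many of
   them.  There are no more than continuum many characters because each one is
   determined by its values at the e_n, which are rational. *)
Require Import Defs.
From HB Require Import structures.
From mathcomp Require Import all_boot all_order all_algebra.
From mathcomp Require Import all_classical all_reals all_analysis.
From mathcomp Require Import zify ring lra.
Import numFieldNormedType.Exports.

Set Implicit Arguments.
Unset Strict Implicit.
Unset Printing Implicit Defensive.

Import Order.TTheory GRing.Theory Num.Theory.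
Local Open Scope classical_set_scope.
Local Open Scope ring_scope.
Local Open Scope card_scope.

(** * Arcs of the circle, and the rational circle inside the real one *)

Lemma pi_mod_int_eq0 (K : archiNumDomainType) (r : K) :
  (\pi_(mod_int K)%qT r == 0) = (r \is a Num.int).
Proof. by rewrite -[0](raddf0 \pi_(mod_int K)%qT) -Quotient.idealrBE subr0. Qed.

Lemma pi_circle_eq0 (R : realType) (r : R) :
  (\pi_(circle R)%qT r == 0) = (r \is a Num.int).
Proof. exact: pi_mod_int_eq0. Qed.

Lemma int_norm_lt1_eq0 (R : realType) (r : R) :
  r \is a Num.int -> `|r| < 1 -> r = 0.
Proof.
move=> /intrP[m ->]; rewrite -intr_norm -[1]/(1%:~R) ltr_int => m1.
by have -> : m = 0 by lia.
Qed.

Section circle_theory.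
Variable R : realType.
Local Notation toC := \pi_(circle R)%qT.

(** The saturation of a real ball is the union of its integer translates, hence open, so images of
    balls form a neighbourhood base in the quotient. *)
Lemma circle_nbhsP (c : circle R) (V : set (circle R)) :
  nbhs c V <-> exists2 e : R, 0 < e & forall r, `|r| < e -> V (c + toC r).
Proof.
split.
  rewrite nbhsE => -[B [oB Bc] BV].
  have : nbhs (repr c : R) (toC @^-1` B).
    by apply: open_nbhs_nbhs; split => //=; rewrite reprK.
  move=> /nbhs_ballP[e /= e0 eB]; exists e => // r re; apply: BV.
  rewrite -[c]reprK -raddfD/=; apply: eB.
  by rewrite -ball_normE /= opprD addNKr normrN.
move=> [e e0 eV]; rewrite nbhsE.
exists (toC @` ball (repr c : R) e); last first.
  move=> _ [r /= + <-]; rewrite -ball_normE /= distrC => re.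
  have := eV _ re; rewrite raddfB/= reprK.
  by rewrite [X in V X -> _]addrC subrK.
split; last by exists (repr c); [exact: ballxx|rewrite reprK].
rewrite /open/= /circle_open/=.
have -> : toC @^-1` (toC @` ball (repr c : R) e) =
    \bigcup_(m : int) ball (repr c + m%:~R : R) e.
  apply/seteqP; split => [r /= [s se sr]|r [m _ rm]].
    have /intrP[m mE] : r - s \is a Num.int.
      by rewrite -pi_circle_eq0 raddfB/= sr subrr.
    exists m => //; move: se; rewrite -!ball_normE /=.
    by rewrite -mE (_ : repr c + (r - s) - r = repr c - s) //; ring.
  exists (r - m%:~R).
    move: rm; rewrite -!ball_normE/=.
    by rewrite (_ : repr c - (r - m%:~R) = repr c + m%:~R - r) //; ring.
  by apply/eqP; rewrite -subr_eq0 -raddfB pi_circle_eq0 addrAC subrr add0r rpredN intr_int.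
by apply: bigcup_open => m _; exact: ball_open.
Qed.

(** Two representatives below 1/2 in absolute value differ by an integer of absolute value below 1,
    so they coincide. A non-zero one could therefore not be undercut by a smaller one. *)
Lemma circle_eq0_small (c : circle R) :
  (forall e : R, 0 < e -> exists2 r : R, `|r| < e & toC r = c) -> c = 0.
Proof.
move=> small; have [r r2 rc] : exists2 r : R, `|r| < 2^-1 & toC r = c.
  by apply: small; rewrite invr_gt0.
have [r0|r0] := eqVneq r 0; first by rewrite -rc r0 raddf0.
have [s sr sc] : exists2 s : R, `|s| < `|r| & toC s = c.
  by apply: small; rewrite normr_gt0.
have : r - s = 0.
  apply: int_norm_lt1_eq0; first by rewrite -pi_circle_eq0 raddfB/= rc sc subrr.
  apply: le_lt_trans (ler_normB _ _) _; lra.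
by move=> /eqP; rewrite subr_eq0 => /eqP rs; move: sr; rewrite rs ltxx.
Qed.

Lemma circle_repr01 (c : circle R) : exists2 r : R, 0 <= r < 1 & c = toC r.
Proof.
exists (repr c - (Num.floor (repr c))%:~R).
  by have := floor_itv (repr c); rewrite intrD subr_ge0 ltrBlDr addrC.
apply/eqP; rewrite -[c in c == _]reprK -subr_eq0 -raddfB pi_circle_eq0 opprB.
by rewrite addrC subrK intr_int.
Qed.

(** This is the inclusion of Q/Z in R/Z; by [circle_of_ratE] the chosen representative does not
    matter. *)
Definition circle_of_rat (q : mod_int rat) : circle R := toC (ratr (repr q)).

Lemma circle_of_ratE (q : rat) :
  circle_of_rat (\pi_(mod_int rat)%qT q) = toC (ratr q).
Proof.
apply/eqP; rewrite /circle_of_rat -subr_eq0 -raddfB pi_circle_eq0 -rmorphB/=.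
have /intrP[m ->] : repr (\pi_(mod_int rat)%qT q) - q \is a Num.int.
  by rewrite -pi_mod_int_eq0 raddfB/= reprK subrr.
by rewrite ratr_int intr_int.
Qed.

Lemma circle_of_rat_is_zmod_morphism : zmod_morphism circle_of_rat.
Proof.
move=> q q'; rewrite -[q]reprK -[q']reprK -raddfB !circle_of_ratE.
by rewrite !raddfB.
Qed.
HB.instance Definition _ := GRing.isZmodMorphism.Build _ _ circle_of_rat
  circle_of_rat_is_zmod_morphism.

Lemma circle_of_rat_inj : injective circle_of_rat.
Proof.
apply: raddf_inj => q /=; rewrite -[q]reprK circle_of_ratE => /eqP.
rewrite pi_circle_eq0 => /intrP[m mE]; apply/eqP; rewrite pi_mod_int_eq0.
suff -> : repr q = m%:~R by rewrite intr_int.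
by apply: (fmorph_inj (@ratr R)); rewrite /= ratr_int.
Qed.

End circle_theory.

(** * The group topology induced by a single character *)

Section initial_group_topology.
Variables (R : realType) (G : zmodType) (f : {additive G -> circle R}).
Local Notation toC := \pi_(circle R)%qT.

Let initial_open : set_system G := @open (initial_topology f).
Let initial_openT : initial_open setT.
Proof. exact: (@openT (initial_topology f)). Qed.
Let initial_openI : setI_closed initial_open.
Proof. exact: (@openI (initial_topology f)). Qed.
Let initial_open_bigcup (I : Type) (F : I -> set G) :
  (forall i, initial_open (F i)) -> initial_open (\bigcup_i F i).
Proof. by move=> oF; apply: (@bigcup_open (initial_topology f)) => i _; exact: oF. Qed.

Definition initial_topology_on : topology_on G :=
  TopologyOn initial_openT initial_openI initial_open_bigcup.

Let T := topologized initial_topology_on.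

Lemma initial_nbhsP (g : G) (U : set G) :
  nbhs (g : T) U <->
  exists2 e : R, 0 < e &
    forall h r, `|r| < e -> f h = f g + toC r -> U h.
Proof.
split.
  rewrite nbhsE => -[B [[V oV VB] Bg] BU].
  have /circle_nbhsP[e e0 eV] : nbhs (f g) V.
    by apply: open_nbhs_nbhs; split => //; move: Bg; rewrite -VB.
  exists e => // h r re hE; apply: BU; rewrite -VB /= hE; exact: eV.
move=> [e e0 eU].
have : nbhs (f g) [set c | exists2 r, `|r| < e & c = f g + toC r].
  by apply/circle_nbhsP; exists e => // r re; exists r.
rewrite nbhsE => -[V [oV Vg] VU].
rewrite nbhsE; exists (f @^-1` V).
  by split => //; exists V.
by move=> h /VU[r re]; exact: eU.
Qed.

Lemma initial_topology_sub : continuous (fun z : T * T => (z.1 - z.2 : T)).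
Proof.
move=> -[z1 z2] U /= /initial_nbhsP[e e0 eU].
pose W z := [set h : T | exists2 r, `|r| < e / 2 & f h = f z + toC r].
have nW z : nbhs (z : T) (W z).
  by apply/initial_nbhsP; exists (e / 2); [rewrite divr_gt0|move=> h r; exists r].
exists (W z1, W z2) => //= -[h1 h2] /= [[r1 r1e h1E] [r2 r2e h2E]].
apply: (eU _ (r1 - r2)).
  by apply: le_lt_trans (ler_normB _ _) _; lra.
by rewrite !raddfB /= h1E h2E opprD addrACA.
Qed.

Definition initial_group_topology : group_topology G :=
  GroupTopology initial_topology_sub.

Lemma initial_group_topology_cvg (a : nat -> G) :
  (f \o a) @ \oo --> (0 : circle R) -> converges_to_0 a initial_group_topology.
Proof.
move=> fa U /initial_nbhsP[e e0 eU].
have : nbhs (0 : circle R) [set c | exists2 r, `|r| < e & c = toC r].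
  by apply/circle_nbhsP; exists e => // r re; exists r => //; rewrite add0r.
move=> /fa /= [N _ aN]; exists N => // n /aN[r re afE].
by apply: (eU _ r) => //; rewrite raddf0 add0r.
Qed.

Hypothesis f_inj : injective f.

(** If g and h cannot be separated, arcs of radius e/2 around their images meet for every e, so f (h
    - g) has arbitrarily small representatives and vanishes. *)
Lemma initial_group_topology_hausdorff :
  hausdorff_space (with_topology initial_group_topology).
Proof.
move=> g h gh; apply/eqP; rewrite -subr_eq0; apply/eqP/f_inj; rewrite raddf0.
apply: circle_eq0_small => e e0.
pose W z := [set y : T | exists2 r, `|r| < e / 2 & f y = f z + toC r].
have nW z : nbhs (z : T) (W z).
  by apply/initial_nbhsP; exists (e / 2); [rewrite divr_gt0|move=> y r; exists r].
have [y [[r1 r1e gE] [r2 r2e hE]]] := gh _ _ (nW g) (nW h).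
exists (r2 - r1); first by apply: le_lt_trans (ler_normB _ _) _; lra.
rewrite !raddfB /=; apply/eqP; rewrite subr_eq addrAC eq_sym subr_eq.
by rewrite -gE hE addrC.
Qed.

(* Every [f g] lies in one of [N] arcs of length [1 / N]; one point of [G] for
   each arc that is met suffices. *)
Lemma initial_group_topology_precompact :
  precompact_group (with_topology initial_group_topology).
Proof.
move=> U /initial_nbhsP[e e0 eU].
pose N := (Num.truncn e^-1).+1.
have Ne : (N%:R^-1 : R) < e.
  by rewrite invf_plt ?posrE ?ltr0n// truncnS_gt.
pose arc (i : nat) : set G :=
  [set g | exists2 r : R, i%:R <= r * N%:R < i.+1%:R & f g = toC r].
pose F := [set xget 0 (arc i) | i in `I_N].
exists F; first by apply: finite_image; exact: finite_II.
apply/esym/seteqP; split => // g _.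
have [r r01 rE] := circle_repr01 (f g).
pose i := Num.truncn (r * N%:R).
have iP : i%:R <= r * N%:R < i.+1%:R.
  apply: truncn_itv; rewrite mulr_ge0//; by case/andP: r01.
have iN : (i < N)%N.
  rewrite -(ltr_nat R); case/andP: iP => /le_lt_trans + _; apply.
  by rewrite gtr_pMl ?ltr0n//; case/andP: r01.
have [s siP sE] : arc i (xget 0 (arc i)) by apply: (xgetPex 0); exists g, r.
exists (xget 0 (arc i)); first by exists i.
exists (g - xget 0 (arc i)); last by rewrite addrC subrK.
apply: (eU _ (r - s)); last first.
  rewrite raddf0 add0r -[LHS]/(f (g - _ : G)) raddfB rE sE.
  by rewrite raddfB.
apply: lt_trans Ne.
rewrite -(@ltr_pM2r _ N%:R) ?ltr0n// mulVf ?pnatr_eq0//.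
rewrite -[X in _ * X](@ger0_norm _ N%:R)// -normrM mulrBl.
by rewrite ltr_norml; move: siP iP; rewrite -natr1; lra.
Qed.

End initial_group_topology.

(** * Torsion and cyclic subgroups of the Prüfer group *)

Section prufer_theory.
Variables (p : nat) (p_prime : prime p).

Let p_gt0 : (0 < p)%N := prime_gt0 p_prime.
Let pn_gt0 n : (0 < p ^ n)%N. Proof. by rewrite expn_gt0 p_gt0. Qed.
Let pn_neq0 n : (p ^ n)%:R != 0 :> rat.
Proof. by rewrite pnatr_eq0 -lt0n. Qed.

Lemma prufer_torsion (y : prufer p) : exists k, y *+ p ^ k = 0.
Proof.
have /asboolP[k yk] := prufer_valP y; exists k; apply/val_inj.
by rewrite raddfMn raddf0.
Qed.

Lemma val_prufer_e_mulrn n c :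
  val (prufer_e p n *+ c) = \pi_(mod_int rat)%qT (c%:R / (p ^ n)%:R).
Proof. by rewrite mulr_natl !raddfMn. Qed.

Lemma prufer_e_mulrn_eq0 n c : (prufer_e p n *+ c == 0) = (p ^ n %| c)%N.
Proof.
rewrite -val_eqE val_prufer_e_mulrn -[val 0]/(0 : mod_int rat) pi_mod_int_eq0.
apply/intrP/dvdnP => [[m mE]|[d ->]]; last first.
  by exists d; rewrite natrM mulfK.
exists `|m|%N; apply/eqP; rewrite -(eqr_nat rat) natrM natr_absz.
have /eqP : c%:R = m%:~R * (p ^ n)%:R :> rat by rewrite -mE divfK.
by rewrite ger0_norm // -(ler0z rat) -mE divr_ge0 ?ler0n.
Qed.

Lemma prufer_e_order n : prufer_e p n *+ p ^ n = 0.
Proof. by apply/eqP; rewrite prufer_e_mulrn_eq0. Qed.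

Lemma prufer_eD n m : prufer_e p (n + m) *+ p ^ m = prufer_e p n.
Proof.
apply/val_inj; rewrite val_prufer_e_mulrn -[prufer_e p n]mulr1n.
rewrite val_prufer_e_mulrn expnD natrM invfM; congr \pi_(mod_int rat)%qT.
by rewrite mulrCA mulfV// mulr1 mul1r.
Qed.

Lemma prufer_cyclic (y : prufer p) k :
  y *+ p ^ k = 0 -> exists c : nat, y = prufer_e p k *+ c.
Proof.
move=> yk; pose r : rat := repr (val y).
have /intrP[m mE] : r * (p ^ k)%:R \is a Num.int.
  rewrite -pi_mod_int_eq0 mulr_natr raddfMn /= reprK -raddfMn.
  by rewrite yk raddf0.
(* Reducing the numerator m modulo p^k makes it a natural number and changes the fraction m / p^k by
   an integer only. *)
exists `|(m %% (p ^ k)%:Z)%Z|%N; apply/val_inj; rewrite val_prufer_e_mulrn.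
rewrite -[val y]reprK; apply/eqP; rewrite -subr_eq0 -raddfB pi_mod_int_eq0.
rewrite natr_absz ger0_norm ?modz_ge0//; last by rewrite eqz_nat -lt0n.
have -> : repr (val y) = m%:~R / (p ^ k)%:R by rewrite -mE mulfK.
rewrite -mulrBl -intrB {1}(divz_eq m (p ^ k)%:Z) addrK intrM.
by rewrite -pmulrn mulfK ?intr_int.
Qed.

(** If p^m fixed y, so would every p^(m i); but for large i this power kills y. *)
Lemma prufer_sub_mulrn_neq0 (y : prufer p) m :
  y != 0 -> (0 < m)%N -> y *+ p ^ m - y != 0.
Proof.
move=> y0 m0; apply: contraNneq y0 => ym.
have ymE : y *+ p ^ m = y by apply/eqP; rewrite -subr_eq0 ym.
have [k yk] := prufer_torsion y.
have yi i : y *+ p ^ (m * i) = y.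
  by elim: i => [|i IH]; rewrite ?muln0 ?mulr1n// mulnS expnD mulrnA ymE.
by rewrite -(yi k) -(subnK (leq_pmull k m0)) expnD mulnC mulrnA yk mul0rn.
Qed.

End prufer_theory.

(** * Necessity of unbounded gaps *)

Lemma cvg0_mulrn (A : topologicalZmodType) (u : nat -> A) n :
  u @ \oo --> (0 : A) -> (fun k => u k *+ n) @ \oo --> (0 : A).
Proof.
move=> u0; elim: n => [|n IH].
  by under eq_fun do rewrite mulr0n; exact: cvg_cst.
under eq_fun do rewrite mulrS.
have := cvg_comp2 u0 IH (@add_continuous A (0, 0)).
by rewrite /= addr0; apply; exact: nbhs_filter.
Qed.

Lemma cvg0_mulrnB (A : topologicalZmodType) (u v : nat -> A) n :
  u @ \oo --> (0 : A) -> v @ \oo --> (0 : A) ->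
  (fun k => u k *+ n - v k) @ \oo --> (0 : A).
Proof.
move=> u0 v0.
have := cvg_comp2 (h := fun y z : A => y - z) (cvg0_mulrn n u0) v0
  (@sub_continuous A (0, 0)).
by rewrite /= subr0; apply; exact: nbhs_filter.
Qed.

Lemma T_sequence_gap (p : nat) (p_prime : prime p) (x : prufer p)
    (n_ : nat -> nat) :
  x != 0 -> (forall k, (n_ k < n_ k.+1)%N) ->
  T_sequence (fun k => - x + prufer_e p (n_ k)) ->
  (fun k => (n_ k.+1 - n_ k)%N) @ \oo --> \oo.
Proof.
move=> x0 n_incr [t [hT aT]]; apply/cvgnyPge.
(* Avoiding each single value eventually is enough: the lower bound on the gaps is raised by one at
   a time. *)
suff gap_neq m : \forall k \near \oo, (n_ k.+1 - n_ k)%N != m.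
  elim=> [|A IH]; first exact: nearW.
  by apply: filterS2 (gap_neq A) IH => k kA Ak; rewrite ltn_neqAle eq_sym kA.
have [->|m0] := posnP m.
  by apply: nearW => k; rewrite -lt0n subn_gt0.
pose a k : with_topology t := - x + prufer_e p (n_ k).
(* Otherwise this non-zero constant would lie in every neighbourhood of 0, against separation. *)
have [U nU Uy] : exists2 U : set (with_topology t),
    nbhs 0 U & ~ U (- (x *+ p ^ m - x)).
  apply/not_exists2P => H; case/negP: (prufer_sub_mulrn_neq0 x0 m0).
  rewrite -oppr_eq0; apply/eqP/esym/hT => B C nB nC.
  exists (- (x *+ p ^ m - x)); split; last exact: (@nbhs_singleton (with_topology t) _ _ nC).
  by have [//|/contrapT] := H B.
have a0 : a @ \oo --> (0 : with_topology t) := aT.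
have aS0 : (fun k => a k.+1) @ \oo --> (0 : with_topology t).
  by apply: cvg_comp a0; exact: (cvg_addnl 1).
have [N _ NU] := cvg0_mulrnB (p ^ m) aS0 a0 nU.
exists N => // k /NU /= Uk; apply/eqP => gm.
apply: Uy; move: Uk; congr U.
(* For a gap equal to m, p^m e_(n_(k+1)) = e_(n_k), so only the terms in x survive. *)
rewrite /a -(subnKC (ltnW (n_incr k))) gm.
rewrite mulrnDl mulNrn prufer_eD// !opprD !opprK addrACA.
by rewrite subrr addr0.
Qed.

(** * Multiplication by p-adic integers with free binary digits *)

Section digit_endomorphism.
Variables (p : nat) (p_prime : prime p) (n_ : nat -> nat).
Hypothesis n_incr : forall k l : nat, (k < l)%N -> (n_ k < n_ l)%N.
Variables (s c K : nat).
Hypothesis gapK : forall k, (K <= k)%N -> (n_ k + s < n_ k.+1)%N.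

Let p_gt0 : (0 < p)%N := prime_gt0 p_prime.
Let p_gt1 : (1 < p)%N := prime_gt1 p_prime.

Let n_homo k l : (k <= l)%N -> (n_ k <= n_ l)%N.
Proof. by rewrite leq_eqVlt => /predU1P[->//|/n_incr/ltnW]. Qed.

Let n_ge k : (k <= n_ k)%N.
Proof. by elim: k => // k IH; exact: leq_ltn_trans IH (n_incr _). Qed.

Section digits.
Variable b : nat -> bool.

(** For s <= n_j this is the natural number (c / p^s + b_j) p^(n_j); the pair s, c will come from x
    = c e_s. *)
Definition digit_block (j : nat) : nat := (c * p ^ (n_ j - s) + b j * p ^ n_ j)%N.

(* Truncations of the p-adic integer
   [1 + \sum_(j >= K) (c / p ^ s + b j) p ^ n_ j]. *)
Definition digit_sum (k : nat) : nat := (1 + \sum_(K <= j < k) digit_block j)%N.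

Lemma digit_sumS k : (K <= k)%N ->
  digit_sum k.+1 = (digit_sum k + digit_block k)%N.
Proof. by move=> Kk; rewrite /digit_sum big_nat_recr//= addnA. Qed.

Lemma digit_sum_small k : (k <= K)%N -> digit_sum k = 1%N.
Proof. by move=> kK; rewrite /digit_sum big_geq. Qed.

Lemma dvdn_digit_block i j : (i + s <= n_ j)%N -> (p ^ i %| digit_block j)%N.
Proof.
move=> ij; rewrite dvdn_add// dvdn_mull// dvdn_exp2l//; lia.
Qed.

(** Blocks from k on are multiples of p^i and kill y. This stability is what gives the infinite
    p-adic sum an action on torsion elements. *)
Lemma mulrn_digit_sum_stable (y : prufer p) i k l :
  y *+ p ^ i = 0 -> (i + s <= n_ k)%N -> (K <= k <= l)%N ->
  y *+ digit_sum l = y *+ digit_sum k.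
Proof.
move=> yi ik /andP[Kk]; elim: l => [|l IH]; first by rewrite leqn0 => /eqP ->.
rewrite leq_eqVlt => /predU1P[->//|]; rewrite ltnS => kl.
rewrite digit_sumS ?(leq_trans Kk)// mulrnDr IH//.
have /dvdnP[d ->] : (p ^ i %| digit_block l)%N.
  exact/dvdn_digit_block/(leq_trans ik)/n_homo.
by rewrite mulnC mulrnA yi mul0rn addr0.
Qed.

(** The truncation index is far enough for the chosen exponent because k <= n_k; [digit_mulE] shows
    that the choice is immaterial. *)
Definition digit_mul (y : prufer p) : prufer p :=
  y *+ digit_sum (K + sval (cid (prufer_torsion y)) + s).

Lemma digit_mulE (y : prufer p) i k :
  y *+ p ^ i = 0 -> (i + s <= n_ k)%N -> (K <= k)%N ->
  digit_mul y = y *+ digit_sum k.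
Proof.
rewrite /digit_mul; case: cid => j /= yj yi ik Kk.
set l := (K + j + s)%N.
have jl : (j + s <= n_ l)%N by rewrite (leq_trans _ (n_ge l))// /l; lia.
have Kl : (K <= l)%N by rewrite /l; lia.
have [kl|/ltnW lk] := leqP k l.
  by rewrite (mulrn_digit_sum_stable yi ik)// Kk.
by rewrite (mulrn_digit_sum_stable yj jl)// Kl.
Qed.

Lemma digit_mul_is_zmod_morphism : zmod_morphism digit_mul.
Proof.
move=> y z; have [i yi] := prufer_torsion y; have [j zj] := prufer_torsion z.
(* One truncation serves y, z and y - z, all killed by p^(i + j). *)
pose k := (K + (i + j) + s)%N.
have ijk : (i + j + s <= n_ k)%N by rewrite (leq_trans _ (n_ge k))// /k; lia.
have Kk : (K <= k)%N by rewrite /k; lia.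
have yij : y *+ p ^ (i + j) = 0 by rewrite expnD mulrnA yi mul0rn.
have zij : z *+ p ^ (i + j) = 0 by rewrite addnC expnD mulrnA zj mul0rn.
rewrite (digit_mulE yij ijk Kk) (digit_mulE zij ijk Kk) -mulrnBl.
by apply: (digit_mulE _ ijk Kk); rewrite mulrnBl yij zij subrr.
Qed.
HB.instance Definition _ := GRing.isZmodMorphism.Build _ _ digit_mul
  digit_mul_is_zmod_morphism.

(** All blocks kill y, leaving the leading term 1. The case i = s fixes x, and i = 1 yields
    injectivity. *)
Lemma digit_mul_id (y : prufer p) i :
  y *+ p ^ i = 0 -> (i + s <= n_ K)%N -> digit_mul y = y.
Proof. by move=> yi iK; rewrite (digit_mulE yi iK)// digit_sum_small. Qed.

(** Block k sends e_(n_k) to c e_s, its binary digit being killed by the factor p^(n_k). Later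
    blocks vanish since the gaps exceed s. *)
Lemma digit_mul_e k : (K <= k)%N -> (s <= n_ k)%N ->
  digit_mul (prufer_e p (n_ k)) =
  prufer_e p s *+ c + prufer_e p (n_ k) *+ digit_sum k.
Proof.
move=> Kk sk; rewrite (@digit_mulE _ (n_ k) k.+1)//; last 3 first.
- exact: prufer_e_order.
- exact/ltnW/gapK.
- exact: leqW.
rewrite digit_sumS// mulrnDr addrC; congr (_ + _).
rewrite /digit_block mulrnDr [(b k * _)%N]mulnC [X in _ + X]mulrnA.
rewrite prufer_e_order// mul0rn addr0 mulnC mulrnA.
by rewrite -[in prufer_e p (n_ k)](subnKC sk) prufer_eD.
Qed.

(** By induction on the exponent, p y vanishes for y in the kernel; then y is killed by p and hence
    fixed, so y = 0. *)
Lemma digit_mul_inj : (s < n_ K)%N -> injective digit_mul.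
Proof.
move=> sK; apply: raddf_inj => y /= y0; have [i] := prufer_torsion y.
elim: i y y0 => [|i IH] y y0; first by rewrite expn0 mulr1n.
rewrite expnS mulrnA => yi.
have yp : y *+ p ^ 1 = 0 by rewrite expn1; apply: IH => //; rewrite raddfMn /= y0 mul0rn.
by rewrite -y0 (digit_mul_id yp).
Qed.

(** A block is at most (c + 1) p^(n_j) and these powers at least double, so the induction needs C /
    2 + (c + 1) <= C, which C = 2 c + 4 satisfies. *)
Lemma digit_sum_le k : (digit_sum k.+1 <= (2 * c + 4) * p ^ n_ k)%N.
Proof.
have block_le j : (digit_block j <= (c + 1) * p ^ n_ j)%N.
  rewrite mulnDl leq_add// ?leq_mul2l ?leq_exp2l ?leq_subr ?orbT//.
  by rewrite leq_mul2r leq_b1 orbT.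
have pn_gt0 j : (0 < p ^ n_ j)%N by rewrite expn_gt0 p_gt0.
have step j : (digit_sum j.+1 <= digit_sum j + (c + 1) * p ^ n_ j)%N.
  have [Kj|jK] := leqP K j; first by rewrite digit_sumS// leq_add2l.
  by rewrite !digit_sum_small ?(ltnW jK)//; exact: leq_addr.
elim: k => [|k IH].
  apply: leq_trans (step 0%N) _; rewrite /digit_sum big_geq//.
  have := pn_gt0 0%N; nia.
apply: leq_trans (step _) _.
have pk : (2 * p ^ n_ k <= p ^ n_ k.+1)%N.
  apply: (@leq_trans (p ^ (n_ k).+1)); first by rewrite expnS leq_mul2r p_gt1 orbT.
  by rewrite leq_exp2l// n_incr.
nia.
Qed.

Variable R : realType.

Definition digit_character : {additive prufer p -> circle R} :=
  @circle_of_rat R \o (val \o digit_mul).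

Lemma digit_character_inj : (s < n_ K)%N -> injective digit_character.
Proof.
move=> sK; apply: inj_comp (@circle_of_rat_inj R) _.
exact: inj_comp val_inj (digit_mul_inj sK).
Qed.

Lemma digit_character_cvg0 (x : prufer p) :
  x = prufer_e p s *+ c -> (s + s <= n_ K)%N ->
  (fun k => (n_ k.+1 - n_ k)%N) @ \oo --> \oo ->
  (fun k => digit_character (- x + prufer_e p (n_ k))) @ \oo -->
    (0 : circle R).
Proof.
move=> xE ssK /cvgnyPge gap U /circle_nbhsP[e e0 eU].
pose C : R := (2 * c + 4)%:R.
(* From N on the gap exceeds C / e, and so does p raised to it. *)
have [N _ NP] := gap (Num.truncn (C / e)).+1.
(* The error at index k + 1 is governed by the gap preceding it, hence the successor. *)
exists (maxn N K).+1 => // -[//|k]; rewrite /= ltnS geq_max => /andP[Nk Kk].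
have Kk1 : (K <= k.+1)%N by exact: leqW.
rewrite /digit_character /= raddfD raddfN /= digit_mul_e//; last first.
  by apply: leq_trans (n_homo Kk1); apply: leq_trans ssK; exact: leq_addr.
rewrite (@digit_mul_id x s)//; last first.
  by rewrite xE -mulrnA mulnC mulrnA prufer_e_order// mul0rn.
(* The two copies of x cancel; the error left is the class of [digit_sum k.+1] over p^(n_(k+1)). *)
rewrite -xE addKr val_prufer_e_mulrn circle_of_ratE -[X in U X]add0r; apply: eU.
rewrite fmorph_div /= !ratr_nat ger0_norm ?divr_ge0//.
have pk_gt0 j : 0 < (p ^ n_ j)%:R :> R by rewrite ltr0n expn_gt0 p_gt0.
rewrite ltr_pdivrMr//.
apply: (@le_lt_trans _ _ (C * (p ^ n_ k)%:R)); first by rewrite -natrM ler_nat digit_sum_le.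
rewrite -(subnKC (ltnW (n_incr (ltnSn k)))) expnD natrM.
rewrite mulrCA [C * _]mulrC ltr_pM2l//.
rewrite [e * _]mulrC -ltr_pdivrMr//.
apply: lt_le_trans (truncnS_gt _) _; rewrite ler_nat.
by apply: leq_trans (NP _ Nk) _; exact/ltnW/ltn_expl.
Qed.

End digits.

(** At e_(n_k + 1) the blocks after k vanish and those before k agree, so the values differ by
    p^(n_k) e_(n_k + 1) up to sign, which is non-zero. *)
Lemma digit_mul_neq (b b' : nat -> bool) k :
  (K <= k)%N -> (forall j, (K <= j < k)%N -> b j = b' j) -> b k != b' k ->
  digit_mul b (prufer_e p (n_ k).+1) != digit_mul b' (prufer_e p (n_ k).+1).
Proof.
move=> Kk bb' bk.
have digitE d : digit_mul d (prufer_e p (n_ k).+1) =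
    prufer_e p (n_ k).+1 *+ digit_sum d k.+1.
  by apply: digit_mulE (prufer_e_order p_prime _) _ (leqW Kk); exact: gapK.
rewrite !digitE !digit_sumS// !mulrnDr.
rewrite [in X in _ != X](@eq_big_nat _ _ _ _ _ _ (digit_block b)); last first.
  by move=> j Kjk; rewrite /digit_block bb'.
rewrite (inj_eq (addrI _)) (inj_eq (addrI _)).
suff : prufer_e p (n_ k).+1 *+ p ^ n_ k != 0.
  by move: bk; case: (b k); case: (b' k) => //= _;
    rewrite mul0n mul1n mulr0n // eq_sym.
by rewrite prufer_e_mulrn_eq0// dvdn_Pexp2l// ltnn.
Qed.

End digit_endomorphism.

(** * Injections between binary sequences and real numbers *)

Lemma first_difference (b b' : nat -> bool) : b <> b' ->
  exists2 k, b k != b' k & forall j, (j < k)%N -> b j = b' j.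
Proof.
move=> bb'; have ex : exists k, b k != b' k.
  apply: contrapT => /forallNP eq_bb'; apply: bb'; apply/funext => k.
  by apply/eqP; have /negP := eq_bb' k; rewrite negbK.
case: (ex_minnP ex) => k bk min_k; exists k => // j jk; apply/eqP.
by apply: contraTT jk => /min_k; rewrite -leqNgt.
Qed.

Section cantor_real.
Variable R : realType.

(** In base 3 with digits 0 and 1, a digit 1 outweighs all later digits together, so expansions are
    unique, unlike in base 2. *)
Definition ternary_sum (b : nat -> bool) (n : nat) : R :=
  \sum_(i < n) (b i)%:R / 3 ^+ i.+1.

Definition ternary (b : nat -> bool) : R := sup (range (ternary_sum b)).

(** The upper bound is the geometric sum obtained when all digits from n on are 1. *)
Lemma ternary_sumD b n m :
  ternary_sum b n <= ternary_sum b (n + m) <=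
  ternary_sum b n + (3 ^- n - 3 ^- (n + m)) / 2.
Proof.
elim: m => [|m /andP[IH1 IH2]]; first by rewrite addn0 subrr mul0r addr0 lexx.
rewrite addnS /ternary_sum big_ord_recr -/(ternary_sum b n).
rewrite -/(ternary_sum b (n + m)) /=.
have u0 : 0 < 3 ^- (n + m).+1 :> R by rewrite invr_gt0 exprn_gt0.
have uE : 3 ^- (n + m) = 3 * 3 ^- (n + m).+1 :> R.
  by rewrite [in RHS]exprS invfM mulrA mulfV ?mul1r.
move: IH1 IH2 u0; rewrite uE; set u : R := 3 ^- (n + m).+1; set v : R := 3 ^- n.
move=> IH1 IH2 u0.
have : 0 <= (b (n + m)%N)%:R * u <= u.
  by case: (b _); rewrite /= ?mul1r ?mul0r ?lexx (ltW u0).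
lra.
Qed.

Lemma ternary_itv b n :
  ternary_sum b n <= ternary b <= ternary_sum b n + 3 ^- n / 2.
Proof.
have ub : ubound (range (ternary_sum b)) (ternary_sum b n + 3 ^- n / 2).
  move=> _ [m _ <-].
  have t0 k : 0 < 3 ^- k :> R by rewrite invr_gt0 exprn_gt0.
  have [nm|/ltnW mn] := leqP n m.
    have /andP[_] := ternary_sumD b n (m - n); rewrite subnKC//.
    by have := t0 m; lra.
  have /andP[+ _] := ternary_sumD b m (n - m); rewrite subnKC//.
  by have := t0 n; lra.
apply/andP; split; last by apply: ge_sup ub; exists (ternary_sum b 0), 0%N.
apply: sup_upper_bound; last by exists n.
by split; [exists (ternary_sum b 0), 0%N|eexists; exact: ub].
Qed.

(** At the first difference k the partial sums separate by u = 3^-(k+1), while the tail of the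
    smaller one adds at most u / 2. *)
Lemma ternary_inj : injective ternary.
Proof.
suff lt_ternary b b' k : (forall j, (j < k)%N -> b j = b' j) ->
    ~~ b k -> b' k -> ternary b < ternary b'.
  move=> b b' tt; apply: contrapT => /first_difference[k bk bb'].
  have bb'V j : (j < k)%N -> b' j = b j by move=> /bb'.
  move: bk; case b'k : (b' k); case bk : (b k) => //= _.
    by have := lt_ternary _ _ _ bb' (negbT bk) b'k; rewrite tt ltxx.
  by have := lt_ternary _ _ _ bb'V (negbT b'k) bk; rewrite tt ltxx.
move=> bb' /negbTE bk b'k.
have /andP[_] := ternary_itv b k.+1; have /andP[+ _] := ternary_itv b' k.+1.
have -> : ternary_sum b k.+1 = ternary_sum b k.
  by rewrite /ternary_sum big_ord_recr /= bk mul0r addr0.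
have -> : ternary_sum b' k.+1 = ternary_sum b k + 3 ^- k.+1.
  rewrite /ternary_sum big_ord_recr /= b'k mul1r; congr (_ + _).
  by apply: eq_bigr => i _; rewrite bb'.
have : 0 < 3 ^- k.+1 :> R by rewrite invr_gt0 exprn_gt0.
by set u := 3 ^- _; lra.
Qed.

(** The cut is read along the enumeration of the rationals; indices coding no rational get
    [false]. *)
Definition dedekind_cut (r : R) (j : nat) : bool :=
  if unpickle j is Some q then ratr q < r else false.

Lemma dedekind_cut_inj : injective dedekind_cut.
Proof.
suff lt_cut r r' : r < r' -> dedekind_cut r <> dedekind_cut r'.
  by move=> r r' rr'; have [/lt_cut|/lt_cut/nesym|] := ltgtP r r'.
move=> /rat_in_itvoo[q]; rewrite in_itv /= => /andP[rq qr'].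
move=> /(congr1 (fun h => h (pickle q))); rewrite /dedekind_cut pickleK qr'.
by rewrite lt_gtF.
Qed.

End cantor_real.

(** * Continuity, coding and construction of characters *)

Lemma zmod_morphismMn (U V : zmodType) (f : U -> V) :
  zmod_morphism f -> forall (x : U) n, f (x *+ n) = f x *+ n.
Proof.
move=> fB x n; pose g : {additive U -> V} :=
  HB.pack f (GRing.isZmodMorphism.Build _ _ f fB).
exact: (raddfMn g).
Qed.

(** The topology induced by f makes a tend to 0, so it is coarser than the finest such topology, and
    f is continuous already for it. *)
Lemma finest_continuous_character (R : realType) (G : zmodType) (a : nat -> G)
    (f : {additive G -> circle R}) :
  (f \o a) @ \oo --> (0 : circle R) ->
  continuous_characters R (finest_group a) f.
Proof.
move=> fa; split; first exact: raddfB.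
apply/continuousP => V oV.
have := finest_group_topologyP (initial_group_topology_cvg fa).
by apply; exists V.
Qed.

Lemma circle_torsion_rat (R : realType) (c : circle R) m : (0 < m)%N ->
  c *+ m = 0 -> exists q : rat, c = \pi_(circle R)%qT (ratr q).
Proof.
move=> m0 cm; have /intrP[z zE] : repr c * m%:R \is a Num.int.
  by rewrite -pi_circle_eq0 mulr_natr raddfMn /= reprK cm.
exists (z%:~R / m%:R); rewrite fmorph_div /= ratr_int ratr_nat -zE.
by rewrite mulfK ?reprK// pnatr_eq0 -lt0n.
Qed.

Section prufer_characters.
Variables (R : realType) (p : nat) (p_prime : prime p).

(** A character sends each e_n to a torsion, hence rational, point; the code is the indicator of the
    resulting relation on the countable set of pairs (n, q). *)
Definition character_code (f : prufer p -> circle R) (j : nat) : bool :=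
  if unpickle j is Some (n, q) then
    `[< f (prufer_e p n) = \pi_(circle R)%qT (ratr (q : rat)) >]
  else false.

Lemma character_code_inj (f g : prufer p -> circle R) :
  zmod_morphism f -> zmod_morphism g ->
  character_code f = character_code g -> f = g.
Proof.
move=> fB gB fg.
have fge n : f (prufer_e p n) = g (prufer_e p n).
  have [q fq] : exists q : rat, f (prufer_e p n) = \pi_(circle R)%qT (ratr q).
    apply: (@circle_torsion_rat _ _ (p ^ n)); first by rewrite expn_gt0 prime_gt0.
    by rewrite -zmod_morphismMn// prufer_e_order// -(subrr 0) fB subrr.
  move: fg => /(congr1 (fun h => h (pickle (n, q)))).
  by rewrite /character_code pickleK fq asboolT// => /esym/asboolP ->.
apply/funext => y; have [k yk] := prufer_torsion y.
have [c ->] := prufer_cyclic p_prime yk.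
by rewrite !zmod_morphismMn// fge.
Qed.

Lemma faithful_family (x : prufer p) (n_ : nat -> nat) : x != 0 ->
  (forall k l : nat, (k < l)%N -> (n_ k < n_ l)%N) ->
  (fun k => (n_ k.+1 - n_ k)%N) @ \oo --> \oo ->
  exists F : (nat -> bool) -> {additive prufer p -> circle R},
    [/\ injective (fun b => F b : prufer p -> circle R),
        forall b, injective (F b) &
        forall b, (F b \o (fun k => - x + prufer_e p (n_ k))) @ \oo -->
          (0 : circle R)].
Proof.
move=> x0 n_incr gap; have [s xs] := prufer_torsion x.
have [c xE] := prufer_cyclic p_prime xs.
have [N _ NP] := (cvgnyPgt _).1 gap s.
(* Past N the gaps exceed s; the other summand gives 2 s < n_K, enough both for fixing x and for
   injectivity. *)
pose K := (N + (s + s).+1)%N.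
have nK : (s + s < n_ K)%N.
  have n_ge k : (k <= n_ k)%N.
    by elim: k => // k IH; exact: leq_ltn_trans IH (n_incr _ _ _).
  by apply: leq_trans (n_ge K); rewrite /K; lia.
have gapK k : (K <= k)%N -> (n_ k + s < n_ k.+1)%N.
  move=> Kk; have /NP /= : (N <= k)%N by apply: leq_trans Kk; exact: leq_addr.
  by rewrite ltn_subRL.
(* Digits below K are never read, so b is moved to start at K; otherwise distinct sequences could
   give the same character. *)
pose shift (b : nat -> bool) j := b (j - K)%N.
exists (fun b => digit_character p_prime n_incr s c K (shift b) R).
split=> [b b'|b|b].
- move=> bb'; apply: contrapT => /first_difference[k bk eq_bb'].
  have : shift b (K + k)%N != shift b' (K + k)%N by rewrite /shift addKn.
  have eq_shift j : (K <= j < K + k)%N -> shift b j = shift b' j.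
    by move=> /andP[Kj jk]; apply: eq_bb'; lia.
  move=> /(digit_mul_neq p_prime n_incr c gapK (leq_addr _ _) eq_shift)/eqP.
  apply; apply/val_inj/(@circle_of_rat_inj R).
  exact: (congr1 (fun h => h (prufer_e p (n_ (K + k)).+1)) bb').
- by apply: digit_character_inj; apply: leq_trans nK; rewrite ltnS leq_addr.
- by apply: digit_character_cvg0 => //; exact: ltnW.
Qed.

End prufer_characters.

(** * The equivalences and the cardinalities *)

Theorem theorem4p2 (R : realType) (p : nat) (p_prime : prime p)
    (x : prufer p) (x_neq0 : x != 0)
    (n_ : nat -> nat) (n_pos : forall k : nat, (0 < n_ k)%N)
    (n_incr : forall k l : nat, (k < l)%N -> (n_ k < n_ l)%N) :
  let a : nat -> prufer p := fun k => - x + prufer_e p (n_ k) in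
  (T_sequence a <-> ((fun k : nat => (n_ k.+1 - n_ k)%N) @ \oo --> \oo)) /\
  (T_sequence a <-> TB_sequence a) /\
  (T_sequence a ->
    [/\ maximally_almost_periodic R (finest_group a),
        faithful_characters R (finest_group a) #= [set: R] &
        continuous_characters R (finest_group a) #= [set: R]]).
Proof.
move=> a.
have T_gap : T_sequence a -> (fun k => (n_ k.+1 - n_ k)%N) @ \oo --> \oo.
  by apply: T_sequence_gap => // k; exact: n_incr.
have TB_T : TB_sequence a -> T_sequence a by move=> [t [_ hT aT]]; exists t.
have gap_TB : (fun k => (n_ k.+1 - n_ k)%N) @ \oo --> \oo -> TB_sequence a.
  move=> /(faithful_family R p_prime x_neq0 n_incr)[F [_ F_inj Fa]].
  pose f := F (fun=> false); exists (initial_group_topology f); split.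
  - exact: initial_group_topology_precompact.
  - by apply: initial_group_topology_hausdorff; exact: F_inj.
  - exact/initial_group_topology_cvg/Fa.
split; first by split=> // /gap_TB.
split; first by split=> // /T_gap.
move=> /T_gap/(faithful_family R p_prime x_neq0 n_incr)[F [Finj F_inj Fa]].
have F_faithful b : faithful_characters R (finest_group a) (F b).
  by split; [exact: finest_continuous_character (Fa b)|exact: F_inj].
(* Dedekind cuts supply the free digits, giving one faithful character per real number. *)
have R_le : [set: R] #<= faithful_characters R (finest_group a).
  pose h (r : R) : finest_group a -> circle R := F (dedekind_cut r).
  apply: (@card_le_trans _ _ _ (range h)); last first.
    by apply: subset_card_le => _ [r _ <-]; exact: F_faithful.
  have : range h #= [set: R].
    by apply: inj_card_eq => r r' _ _ /Finj; exact: dedekind_cut_inj.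
  by rewrite card_eq_le => /andP[].
have sub_faithful : faithful_characters R (finest_group a) `<=`
    continuous_characters R (finest_group a) by move=> chi [].
have le_R : continuous_characters R (finest_group a) #<= [set: R].
  apply/pcard_injP; exists (fun chi => ternary R (character_code chi)).
  move=> chi chi' /set_mem[chiB _] /set_mem[chi'B _] /ternary_inj.
  exact: character_code_inj.
split.
- apply/seteqP; split=> y /=.
    (* One faithful character already makes the radical trivial. *)
    move=> /(_ _ (F_faithful (fun=> false)).1) /= y0.
    by apply: (F_inj (fun=> false)); rewrite y0 raddf0.
  move=> -> chi [chiB _] /=; rewrite -(subrr (0 : finest_group a)) chiB.
  by rewrite subrr.
(* Both sets of characters are squeezed between two copies of R, by Cantor-Bernstein. *)
- rewrite card_eq_le R_le andbT.
  exact: card_le_trans (subset_card_le sub_faithful) le_R.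
- rewrite card_eq_le le_R /=.
  exact: card_le_trans R_le (subset_card_le sub_faithful).
Qed.
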